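(* For every closed $\varphi\in\mathrm{cHML}^d$, the synthesised monitor $\mathsf{syn}(\varphi)$ is sound and satisfaction-complete for $\varphi$; that is, for every trace $t\in\mathrm{Trc}$: if $\mathbf{acc}(\mathsf{syn}(\varphi),t)$ then $t\in[\![\varphi]\!]$, and if $t\in[\![\varphi]\!]$ then $\mathbf{acc}(\mathsf{syn}(\varphi),t)$.
   Context: **Data and traces.** Fix a countably infinite set $\mathbb{D}$ (data values) whose only predicate is equality. $\mathrm{Trc}=\mathbb{D}^\omega$; finite traces are elements of $\mathbb{D}^*$. **Logic.** Let $\mathrm{DVar}$, $\mathrm{FVar}$ be countably infinite sets of data variables $x$ and recursion variables $X$; $\star\notin\mathrm{DVar}$ stands for the current data value. Constraint expressions: $b::=\mathsf{true}\mid e=f\mid\neg b\mid b\wedge b$, with $e,f\in\mathrm{DVar}\cup\{\star\}$. $\mathrm{cHML}^d$: $\varphi::=\mathsf{tt}\mid\langle b\rangle\varphi\mid\exists x.\varphi\mid\varphi\vee\varphi\mid\varphi\wedge\varphi\mid\min X.\varphi\mid X$. A data environment $\delta$ is a finite partial function $\mathrm{DVar}\rightharpoonup\mathbb{D}$; data interpretations $F$ map data environments to subsets of $\mathrm{Trc}$ (ordered pointwise by inclusion); trace environments $\rho$ map recursion variables to data interpretations. Semantics: $[\![\mathsf{tt},\rho,\delta]\!]=\mathrm{Trc}$; $[\![X,\rho,\delta]\!]=\rho(X)(\delta)$; $[\![\langle b\rangle\varphi,\rho,\delta]\!]=\{du\mid b\text{ true under }\delta[\star\mapsto d],\ u\in[\![\varphi,\rho,\delta]\!]\}$;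 $[\![\exists x.\varphi,\rho,\delta]\!]=\bigcup_{d\in\mathbb{D}}[\![\varphi,\rho,\delta[x\mapsto d]]\!]$; $\vee,\wedge$ are union, intersection; $[\![\min X.\varphi,\rho,\delta]\!]$ is the value at $\delta$ of the least fixed point of $F\mapsto\lambda\delta'.[\![\varphi,\rho[X\mapsto F],\delta']\!]$. For closed $\varphi$ write $[\![\varphi]\!]$. Standing assumption: each occurrence of a recursion variable is in the scope of a modality inside its defining fixed-point formula. **Monitors.** Syntax: $m::=\mathsf{yes}\mid\mathsf{end}\mid(b).m\mid\mathsf{guess}\,x.m\mid m\oplus m\mid m\otimes m\mid\mathsf{rec}\,X.m\mid X$. Configurations: $c::=(m,\delta)\mid c\odot c$, with $\odot\in\{\oplus,\otimes\}$. Transitions, labelled by $d\in\mathbb{D}$ or by the silent label $\tau$, are those derivable from the following rules ($\odot\in\{\oplus,\otimes\}$): - $(v,\delta)\xrightarrow{d}(v,\delta)$ for $v\in\{\mathsf{yes},\mathsf{end}\}$; - $((b).m,\delta)\xrightarrow{d}(m,\delta)$ if $b$ is true under $\delta[\star\mapsto d]$, and $((b).m,\delta)\xrightarrow{d}(\mathsf{end},\delta)$ if it is false; - $(\mathsf{guess}\,x.m,\delta)\xrightarrow{\tau}(m,\delta[x\mapsto d])$ for any $d\in\mathbb{D}$; - $(\mathsf{rec}\,X.m,\delta)\xrightarrow{\tau}(m[\mathsf{rec}\,X.m/X],\delta)$; - $(m\odot n,\delta)\xrightarrow{\tau}(m,\delta)\odot(n,\delta)$; - if $c_1\xrightarrow{d}c_1'$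 and $c_2\xrightarrow{d}c_2'$ then $c_1\odot c_2\xrightarrow{d}c_1'\odot c_2'$; - if $c_1\xrightarrow{\tau}c_1'$ then $c_1\odot c_2\xrightarrow{\tau}c_1'\odot c_2$; if $c_2\xrightarrow{\tau}c_2'$ then $c_1\odot c_2\xrightarrow{\tau}c_1\odot c_2'$; - $(\mathsf{yes},\delta)\otimes c\xrightarrow{\tau}c$ and $(\mathsf{yes},\delta)\oplus c\xrightarrow{\tau}(\mathsf{yes},\delta)$, and symmetrically with the two components exchanged. Write $c\stackrel{w}{\Longrightarrow}c'$ for $w=d_0\cdots d_l\in\mathbb{D}^*$ if $c'$ is reached from $c$ by a sequence of transitions whose labels, after deleting the $\tau$'s, spell $w$. For $t\in\mathrm{Trc}$, $\mathbf{acc}(m,t)$ holds iff $(m,\varnothing)\stackrel{w}{\Longrightarrow}(\mathsf{yes},\delta')$ for some finite prefix $w$ of $t$ and some $\delta'$. (These monitors never reject.) **Synthesis.** $\mathsf{syn}(\mathsf{tt})=\mathsf{yes}$; $\mathsf{syn}(\exists x.\varphi)=\mathsf{guess}\,x.\mathsf{syn}(\varphi)$; $\mathsf{syn}(\langle b\rangle\varphi)=(b).\mathsf{syn}(\varphi)$; $\mathsf{syn}(\varphi\vee\psi)=\mathsf{syn}(\varphi)\oplus\mathsf{syn}(\psi)$; $\mathsf{syn}(\varphi\wedge\psi)=\mathsf{syn}(\varphi)\otimes\mathsf{syn}(\psi)$; $\mathsf{syn}(\min X.\varphi)=\mathsf{rec}\,X.\mathsf{syn}(\varphi)$; $\mathsf{syn}(X)=X$.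 *)

(* Defs.v *)
From HB Require Import structures.
From mathcomp Require Import all_boot.
From mathcomp Require Import finmap.
From mathcomp Require Import boolp classical_sets functions cardinality.

Set Implicit Arguments.
Unset Strict Implicit.
Unset Printing Implicit Defensive.

Local Open Scope classical_set_scope.

Inductive dterm (DVar : Type) : Type :=
| Star
| DV of DVar.
Arguments Star {DVar}.

Inductive bexpr (DVar : Type) : Type :=
| BTrue
| BEq of dterm DVar & dterm DVar
| BNot of bexpr DVar
| BAnd of bexpr DVar & bexpr DVar.
Arguments BTrue {DVar}.

Inductive formula (DVar FVar : Type) : Type :=
| FTt
| FDia of bexpr DVar & formula DVar FVar
| FEx of DVar & formula DVar FVar
| FOr of formula DVar FVar & formula DVar FVar
| FAnd of formula DVar FVar & formula DVar FVar
| FMin of FVar & formula DVar FVar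
| FRec of FVar.
Arguments FTt {DVar FVar}.
Arguments FRec {DVar FVar}.

Inductive par_op : Type := Oplus | Otimes.

Inductive monitor (DVar FVar : Type) : Type :=
| MYes
| MEnd
| MCond of bexpr DVar & monitor DVar FVar
| MGuess of DVar & monitor DVar FVar
| MPar of par_op & monitor DVar FVar & monitor DVar FVar
| MRec of FVar & monitor DVar FVar
| MVar of FVar.
Arguments MYes {DVar FVar}.
Arguments MEnd {DVar FVar}.
Arguments MVar {DVar FVar}.

Section Syntax.
Variables (DVar FVar : countType).
Implicit Types (b : bexpr DVar) (phi : formula DVar FVar).
Implicit Types (m r : monitor DVar FVar).

Definition dterm_vars (e : dterm DVar) : {fset DVar} :=
  if e is DV x then [fset x]%fset else fset0.

Fixpoint bexpr_vars b : {fset DVar} :=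
  match b with
  | BTrue => fset0
  | BEq e f => (dterm_vars e `|` dterm_vars f)%fset
  | BNot b1 => bexpr_vars b1
  | BAnd b1 b2 => (bexpr_vars b1 `|` bexpr_vars b2)%fset
  end.

Fixpoint free_dvars phi : {fset DVar} :=
  match phi with
  | FTt | FRec _ => fset0
  | FDia b p => (bexpr_vars b `|` free_dvars p)%fset
  | FEx x p => (free_dvars p `\ x)%fset
  | FOr p q | FAnd p q => (free_dvars p `|` free_dvars q)%fset
  | FMin _ p => free_dvars p
  end.

Fixpoint free_fvars phi : {fset FVar} :=
  match phi with
  | FTt => fset0
  | FRec X => [fset X]%fset
  | FDia _ p | FEx _ p => free_fvars p
  | FOr p q | FAnd p q => (free_fvars p `|` free_fvars q)%fset
  | FMin X p => (free_fvars p `\ X)%fset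
  end.

Definition closed_formula phi : Prop :=
  free_dvars phi = fset0 /\ free_fvars phi = fset0.

(* [X] has a free occurrence in [phi] that is not under a modality. *)
Fixpoint exposed (X : FVar) phi : bool :=
  match phi with
  | FTt | FDia _ _ => false
  | FRec Y => Y == X
  | FEx _ p => exposed X p
  | FOr p q | FAnd p q => exposed X p || exposed X q
  | FMin Y p => (Y != X) && exposed X p
  end.

Fixpoint guarded phi : bool :=
  match phi with
  | FTt | FRec _ => true
  | FDia _ p | FEx _ p => guarded p
  | FOr p q | FAnd p q => guarded p && guarded q
  | FMin X p => ~~ exposed X p && guarded p
  end.

(* Substitution of [r] for the free occurrences of [X]. No renaming is needed
   for recursion variables: the monitors unfolded in a run from a closed
   monitor have no free recursion variable. Data variables of [r] are
   deliberately captured by [MGuess]: an unfolding is run in the data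
   environment reached at that point, just as a recursion variable of the
   logic is interpreted in the current data environment. *)
Fixpoint msubst (X : FVar) r m : monitor DVar FVar :=
  match m with
  | MYes | MEnd => m
  | MCond b n => MCond b (msubst X r n)
  | MGuess x n => MGuess x (msubst X r n)
  | MPar o n1 n2 => MPar o (msubst X r n1) (msubst X r n2)
  | MRec Y n => if Y == X then m else MRec Y (msubst X r n)
  | MVar Y => if Y == X then r else m
  end.

Fixpoint syn phi : monitor DVar FVar :=
  match phi with
  | FTt => MYes
  | FDia b p => MCond b (syn p)
  | FEx x p => MGuess x (syn p)
  | FOr p q => MPar Oplus (syn p) (syn q)
  | FAnd p q => MPar Otimes (syn p) (syn q)
  | FMin X p => MRec X (syn p)
  | FRec X => MVar X
  end.

End Syntax.

Section Semantics.
Variables (D DVar FVar : countType).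
Local Notation denv := {fmap DVar -> D}.

Definition trace : Type := nat -> D.

Definition tcons (d : D) (u : trace) : trace :=
  fun n => if n is k.+1 then u k else d.

(* The value of a term under [delta] extended with [Star |-> d]. *)
Definition dterm_val (delta : denv) (d : D) (e : dterm DVar) : option D :=
  if e is DV x then delta.[? x]%fmap else Some d.

(* An equation with an undefined side is false; this never arises from a
   closed formula run or evaluated in the empty environment. *)
Fixpoint holds (delta : denv) (d : D) (b : bexpr DVar) : bool :=
  match b with
  | BTrue => true
  | BEq e f =>
      match dterm_val delta d e, dterm_val delta d f with
      | Some d1, Some d2 => d1 == d2
      | _, _ => false
      end
  | BNot b1 => ~~ holds delta d b1
  | BAnd b1 b2 => holds delta d b1 && holds delta d b2
  end.

Definition dinterp : Type := denv -> set trace.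

Definition dinterp_le (F G : dinterp) : Prop :=
  forall delta, F delta `<=` G delta.

Definition is_lfp (Phi : dinterp -> dinterp) (F : dinterp) : Prop :=
  Phi F = F /\ forall G, Phi G = G -> dinterp_le F G.

(* In the [FMin] case, [F] is the least fixed point: it is unique, and it
   exists because the operator is monotone. *)
Fixpoint sem (phi : formula DVar FVar) (rho : FVar -> dinterp) (delta : denv) :
    set trace :=
  match phi with
  | FTt => setT
  | FRec X => rho X delta
  | FDia b p =>
      [set t | exists d u,
        [/\ t = tcons d u, holds delta d b & sem p rho delta u]]
  | FEx x p => \bigcup_(d in [set: D]) sem p rho (delta.[x <- d])%fmap
  | FOr p q => sem p rho delta `|` sem q rho delta
  | FAnd p q => sem p rho delta `&` sem q rho delta
  | FMin X p =>
      [set t | exists2 F : dinterp,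
        is_lfp (fun G delta' => sem p [eta rho with X |-> G] delta') F &
        F delta t]
  end.

(* For closed formulas the trace environment is irrelevant. *)
Definition csem (phi : formula DVar FVar) : set trace :=
  sem phi (fun _ _ => set0) [fmap]%fmap.

Inductive config : Type :=
| CMon of monitor DVar FVar & denv
| CPar of par_op & config & config.

(* The label [Some d] is the datum [d]; [None] is the silent label. *)
Inductive step : config -> option D -> config -> Prop :=
| step_yes delta d :
    step (CMon MYes delta) (Some d) (CMon MYes delta)
| step_end delta d :
    step (CMon MEnd delta) (Some d) (CMon MEnd delta)
| step_cond_true b m delta d : holds delta d b ->
    step (CMon (MCond b m) delta) (Some d) (CMon m delta)
| step_cond_false b m delta d : ~~ holds delta d b ->
    step (CMon (MCond b m) delta) (Some d) (CMon MEnd delta)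
| step_guess x m delta d :
    step (CMon (MGuess x m) delta) None (CMon m delta.[x <- d]%fmap)
| step_rec X m delta :
    step (CMon (MRec X m) delta) None (CMon (msubst X (MRec X m) m) delta)
| step_fork o m n delta :
    step (CMon (MPar o m n) delta) None (CPar o (CMon m delta) (CMon n delta))
| step_sync o c1 c1' c2 c2' d :
    step c1 (Some d) c1' -> step c2 (Some d) c2' ->
    step (CPar o c1 c2) (Some d) (CPar o c1' c2')
| step_taul o c1 c1' c2 :
    step c1 None c1' -> step (CPar o c1 c2) None (CPar o c1' c2)
| step_taur o c1 c2 c2' :
    step c2 None c2' -> step (CPar o c1 c2) None (CPar o c1 c2')
| step_andl delta c : step (CPar Otimes (CMon MYes delta) c) None c
| step_andr delta c : step (CPar Otimes c (CMon MYes delta)) None c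
| step_orl delta c :
    step (CPar Oplus (CMon MYes delta) c) None (CMon MYes delta)
| step_orr delta c :
    step (CPar Oplus c (CMon MYes delta)) None (CMon MYes delta).

Inductive wsteps : config -> seq D -> config -> Prop :=
| wsteps_refl c : wsteps c [::] c
| wsteps_tau c c' c'' w :
    step c None c' -> wsteps c' w c'' -> wsteps c w c''
| wsteps_data c c' c'' d w :
    step c (Some d) c' -> wsteps c' w c'' -> wsteps c (d :: w) c''.

(* [mkseq t n] is the prefix of [t] of length [n]. *)
Definition acc (m : monitor DVar FVar) (t : trace) : Prop :=
  exists (n : nat) (delta : denv),
    wsteps (CMon m [fmap]%fmap) (mkseq t n) (CMon MYes delta).

Definition sound (m : monitor DVar FVar) (phi : formula DVar FVar) : Prop :=
  forall t : trace, acc m t -> csem phi t.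

Definition satisfaction_complete
    (m : monitor DVar FVar) (phi : formula DVar FVar) : Prop :=
  forall t : trace, csem phi t -> acc m t.

End Semantics.

Arguments sound D {DVar FVar}.
Arguments satisfaction_complete D {DVar FVar}.

(* Main.v *)
(** Soundness: every configuration reached from [syn phi] is built from [end],
    monitors [syn psi] with [psi] closed, and parallel compositions, so it denotes
    a set of traces; each transition can only shrink the denotation (prefixed by
    its label), and [yes] denotes all traces. Recursion is unfolded on the formula
    side, where it preserves the semantics by a substitution lemma.
    Completeness: by induction on [phi] under a closing substitution [sigma], a
    trace satisfying [phi] is accepted by [syn (fsubst sigma phi)]; in the [min]
    case, acceptance by the monitor is a pre-fixed point. Guardedness is needed
    only for disjunctions, where the branch that does not accept must still be
    able to read the prefix on which the other one accepts. *)

Require Import Defs.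
From mathcomp Require Import all_boot.
From mathcomp Require Import finmap.
From mathcomp Require Import boolp classical_sets functions cardinality.

Local Open Scope classical_set_scope.

(** * Least fixed points of monotone operators on data interpretations *)

Section Fixpoints.
Context {D DVar : countType}.
Implicit Types (Phi : dinterp D DVar -> dinterp D DVar) (F G : dinterp D DVar).

Lemma dinterp_le_refl F : dinterp_le F F.
Proof. by move=> delta t. Qed.

Lemma dinterp_le_anti F G : dinterp_le F G -> dinterp_le G F -> F = G.
Proof. by move=> FG GF; apply/funext => delta; apply/seteqP. Qed.

(** The witness is the pointwise intersection of all pre-fixed points. Leastness among pre-fixed
    points, stronger than the clause in [is_lfp], is what induction on [FMin] needs later. *)
Lemma knaster_tarski Phi :
    (forall F G, dinterp_le F G -> dinterp_le (Phi F) (Phi G)) ->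
  exists2 F, is_lfp Phi F &
    forall G, dinterp_le (Phi G) G -> dinterp_le F G.
Proof.
move=> mono.
pose F : dinterp D DVar :=
  fun delta => [set t | forall G, dinterp_le (Phi G) G -> G delta t].
have minF G : dinterp_le (Phi G) G -> dinterp_le F G.
  by move=> leG delta t Ft; apply: Ft.
have leF : dinterp_le (Phi F) F.
  move=> delta t Ft G leG; apply: (leG).
  exact: mono (minF _ leG) _ _ Ft.
exists F => //; split; last first.
  by move=> G eqG; apply: minF; rewrite eqG; apply: dinterp_le_refl.
by apply: dinterp_le_anti (leF) _; apply: minF; apply: mono leF.
Qed.

End Fixpoints.

#[local] Hint Resolve dinterp_le_refl : core.

(** * Monotonicity of the semantics, unfolding and induction for [FMin] *)

Section Logic.
Context {D DVar FVar : countType}.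
Implicit Types (phi psi p : formula DVar FVar) (X Y : FVar).
Implicit Types (rho : FVar -> dinterp D DVar).
Implicit Types (sigma tau : FVar -> formula DVar FVar).

(** Monotonicity of the body is a hypothesis so that the lemma can be used inside the proof of
    [sem_mono], where only the induction hypothesis for [p] is available. Any [F'] witnessing
    membership in the [FMin] set lies below the fixed point [F] by its own leastness. *)
Lemma sem_min_lfp X p rho :
    (forall G G', dinterp_le G G' ->
      dinterp_le (sem p [eta rho with X |-> G]) (sem p [eta rho with X |-> G'])) ->
  sem p [eta rho with X |-> sem (FMin X p) rho] = sem (FMin X p) rho /\
  forall G, dinterp_le (sem p [eta rho with X |-> G]) G ->
    dinterp_le (sem (FMin X p) rho) G.
Proof.
move=> /knaster_tarski[F lfpF minF].
suff -> : sem (FMin X p) rho = F by split=> //; case: lfpF.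
apply: dinterp_le_anti => delta t /=; last by exists F.
by case=> F' [_ minF'] F't; case: (lfpF) => fixF _; apply: minF' F't.
Qed.

Lemma sem_mono {phi} rho rho' :
    (forall X, dinterp_le (rho X) (rho' X)) ->
  dinterp_le (sem phi rho) (sem phi rho').
Proof.
elim: phi rho rho' => [|b p IH|x p IH|p IHp q IHq|p IHp q IHq|X p IH|X]
    rho rho' le_rho delta t.
- by [].
- by case=> d [u [-> bd pu]]; exists d, u; split=> //; apply: (IH _ _ le_rho).
- by case=> d _ pt; exists d => //; apply: (IH _ _ le_rho).
- by case=> [pt|qt]; [left; apply: (IHp _ _ le_rho) | right; apply: (IHq _ _ le_rho)].
- by case=> pt qt; split; [apply: (IHp _ _ le_rho) | apply: (IHq _ _ le_rho)].
- have mono r (G G' : dinterp D DVar) : dinterp_le G G' ->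
      dinterp_le (sem p [eta r with X |-> G]) (sem p [eta r with X |-> G']).
    by move=> leG; apply: IH => Y /=; case: eqP.
  have [_ min] := sem_min_lfp X p rho (mono rho).
  have [fix' _] := sem_min_lfp X p rho' (mono rho').
  (* The fixed point for [rho'], unfolded once, is a pre-fixed point of the operator for [rho]. *)
  apply: min; rewrite -[X in dinterp_le _ X]fix'.
  by apply: IH => Y /=; case: eqP.
- exact: le_rho.
Qed.

Lemma sem_min_mono X p rho (G G' : dinterp D DVar) : dinterp_le G G' ->
  dinterp_le (sem p [eta rho with X |-> G]) (sem p [eta rho with X |-> G']).
Proof. by move=> leG; apply: sem_mono => Y /=; case: eqP. Qed.

Lemma sem_min_unfold X p rho :
  sem p [eta rho with X |-> sem (FMin X p) rho] = sem (FMin X p) rho.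
Proof. by have [] := sem_min_lfp X p rho (@sem_min_mono X p rho). Qed.

(** Park induction: bounding a least fixed point only takes a pre-fixed point [G]. *)
Lemma sem_min_ind {X p rho} G :
    dinterp_le (sem p [eta rho with X |-> G]) G ->
  dinterp_le (sem (FMin X p) rho) G.
Proof. by have [_] := sem_min_lfp X p rho (@sem_min_mono X p rho); apply. Qed.

Lemma eq_sem_free {phi} rho rho' :
  {in free_fvars phi, rho =1 rho'} -> sem phi rho = sem phi rho'.
Proof.
elim: phi rho rho' => [|b p IH|x p IH|p IHp q IHq|p IHp q IHq|X p IH|X]
    rho rho' eq_rho //=.
- by rewrite (IH rho rho').
- by rewrite (IH rho rho').
- rewrite (IHp rho rho') 1?(IHq rho rho') // => Y Yin;
    by apply: eq_rho; rewrite /= inE Yin ?orbT.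
- rewrite (IHp rho rho') 1?(IHq rho rho') // => Y Yin;
    by apply: eq_rho; rewrite /= inE Yin ?orbT.
- suff eqG G : sem p [eta rho with X |-> G] = sem p [eta rho' with X |-> G].
    apply/funext => delta.
    suff -> : (fun G => sem p [eta rho with X |-> G]) =
              (fun G => sem p [eta rho' with X |-> G]) by [].
    exact/funext.
  apply: IH => Y Yin /=; case: eqP => // /eqP neqYX.
  by apply: eq_rho; rewrite /= !inE neqYX.
- by apply: eq_rho; rewrite /= inE.
Qed.

Lemma sem_closed {phi} rho rho' :
  free_fvars phi = fset0 -> sem phi rho = sem phi rho'.
Proof. by move=> cl; apply: eq_sem_free => X; rewrite cl. Qed.

(** * Substitution for recursion variables: syntax, guardedness, semantics and synthesis *)

Fixpoint fsubst sigma phi : formula DVar FVar :=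
  match phi with
  | FTt => FTt
  | FDia b p => FDia b (fsubst sigma p)
  | FEx x p => FEx x (fsubst sigma p)
  | FOr p q => FOr (fsubst sigma p) (fsubst sigma q)
  | FAnd p q => FAnd (fsubst sigma p) (fsubst sigma q)
  | FMin X p => FMin X (fsubst [eta sigma with X |-> FRec X] p)
  | FRec X => sigma X
  end.

(* Under this condition [fsubst] is capture-free. *)
Definition var_or_closed sigma : Prop :=
  forall X, sigma X = FRec X \/ free_fvars (sigma X) = fset0.

Definition closing sigma : Prop :=
  forall X, free_fvars (sigma X) = fset0 /\ guarded (sigma X).

Lemma closing_var_or_closed {sigma} : closing sigma -> var_or_closed sigma.
Proof. by move=> cl X; right; case: (cl X). Qed.

Lemma var_or_closed_upd {sigma} X psi :
    psi = FRec X \/ free_fvars psi = fset0 -> var_or_closed sigma ->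
  var_or_closed [eta sigma with X |-> psi].
Proof. by move=> psiP sigmaP Y /=; case: eqP => [->|]. Qed.

Lemma fsubst_ext phi sigma tau :
  {in free_fvars phi, sigma =1 tau} -> fsubst sigma phi = fsubst tau phi.
Proof.
elim: phi sigma tau => [|b p IH|x p IH|p IHp q IHq|p IHp q IHq|X p IH|X]
    sigma tau eq_st //=.
- by rewrite (IH sigma tau).
- by rewrite (IH sigma tau).
- rewrite (IHp sigma tau) 1?(IHq sigma tau) // => Y Yin;
    by apply: eq_st; rewrite /= inE Yin ?orbT.
- rewrite (IHp sigma tau) 1?(IHq sigma tau) // => Y Yin;
    by apply: eq_st; rewrite /= inE Yin ?orbT.
- congr FMin; apply: IH => Y Yin /=; case: eqP => // /eqP neqYX.
  by apply: eq_st; rewrite /= !inE neqYX.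
- by apply: eq_st; rewrite /= inE.
Qed.

Lemma fsubst_id phi : fsubst FRec phi = phi.
Proof.
elim: phi => [|b p IH|x p IH|p IHp q IHq|p IHp q IHq|X p IH|X] //=;
  rewrite ?IH ?IHp ?IHq //.
congr FMin; rewrite -[RHS]IH; apply: fsubst_ext => Y _ /=.
by case: eqP => [->|].
Qed.

Lemma fsubst_closed {phi} sigma : free_fvars phi = fset0 -> fsubst sigma phi = phi.
Proof.
by move=> cl; rewrite -[RHS]fsubst_id; apply: fsubst_ext => X; rewrite cl.
Qed.

(** Under the binder of [X], the value of [sigma] at another variable [Y] is either [FRec Y] or
    closed, so resetting [tau] at [X] does not affect it. *)
Lemma fsubst_comp phi sigma tau : var_or_closed sigma ->
  fsubst tau (fsubst sigma phi) = fsubst (fun X => fsubst tau (sigma X)) phi.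
Proof.
elim: phi sigma tau => [|b p IH|x p IH|p IHp q IHq|p IHp q IHq|X p IH|X]
    sigma tau ok //=; rewrite ?IH ?IHp ?IHq //; last first.
  by apply: var_or_closed_upd => //; left.
congr FMin; apply: fsubst_ext => Y _ /=; case: eqP => [_|neqYX] /=.
  by rewrite eqxx.
case: (ok Y) => [->|cl] /=; first by case: eqP.
by rewrite !(fsubst_closed _ cl).
Qed.

(** Turns the unfolding of a closed instance of [FMin X p] into an extended closing substitution on
    the body [p], to which a structural induction hypothesis applies. *)
Lemma fsubst_unfold {sigma} X p psi : closing sigma ->
  fsubst [eta FRec with X |-> psi] (fsubst [eta sigma with X |-> FRec X] p) =
  fsubst [eta sigma with X |-> psi] p.
Proof.
move=> cl; rewrite fsubst_comp; last first.
  by apply: var_or_closed_upd (closing_var_or_closed cl); left.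
apply: fsubst_ext => Y _ /=; case: eqP => [_|_] /=; first by rewrite eqxx.
by rewrite fsubst_closed //; case: (cl Y).
Qed.

Lemma free_fvars_fsubst phi sigma Y : Y \in free_fvars (fsubst sigma phi) ->
  exists2 X, X \in free_fvars phi & Y \in free_fvars (sigma X).
Proof.
elim: phi sigma => [|b p IH|x p IH|p IHp q IHq|p IHp q IHq|X p IH|X] sigma /=.
- by rewrite inE.
- exact: IH.
- exact: IH.
- by rewrite inE => /orP[/IHp|/IHq] [X Xin Yin]; exists X => //;
    rewrite inE Xin ?orbT.
- by rewrite inE => /orP[/IHp|/IHq] [X Xin Yin]; exists X => //;
    rewrite inE Xin ?orbT.
- rewrite !inE => /andP[neqYX /IH[Z Zin]] /=.
  case: eqP => [_|/eqP neqZX Yin]; first by rewrite inE (negPf neqYX).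
  by exists Z => //; rewrite !inE neqZX.
- by exists X => //; rewrite inE.
Qed.

Lemma exposed_free X phi : exposed X phi -> X \in free_fvars phi.
Proof.
elim: phi => [|b p IH|x p IH|p IHp q IHq|p IHp q IHq|Y p IH|Y] //=.
- by rewrite inE => /orP[/IHp ->|/IHq ->]; rewrite ?orbT.
- by rewrite inE => /orP[/IHp ->|/IHq ->]; rewrite ?orbT.
- by rewrite !inE eq_sym => /andP[-> /IH].
- by rewrite inE eq_sym.
Qed.

Lemma exposed_fsubst phi sigma Y : exposed Y (fsubst sigma phi) ->
  exists2 X, exposed X phi & exposed Y (sigma X).
Proof.
elim: phi sigma => [|b p IH|x p IH|p IHp q IHq|p IHp q IHq|X p IH|X] sigma //=.
- exact: IH.
- by move=> /orP[/IHp|/IHq] [X Xin Yin]; exists X => //; rewrite Xin ?orbT.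
- by move=> /orP[/IHp|/IHq] [X Xin Yin]; exists X => //; rewrite Xin ?orbT.
- move=> /andP[neqXY /IH[Z Zin]] /=.
  case: eqP => [_|/eqP neqZX Yin]; first by rewrite /= (negPf neqXY).
  by exists Z => //; rewrite eq_sym neqZX.
- by exists X.
Qed.

(** In the [FMin] case, an exposed [X] after substitution comes from some exposed [Y] of the body
    with [X] exposed in the image of [Y]. Closed images expose nothing, so [Y] is [X], which
    guardedness of [phi] excludes. *)
Lemma guarded_fsubst phi sigma : var_or_closed sigma ->
  (forall X, guarded (sigma X)) -> guarded phi -> guarded (fsubst sigma phi).
Proof.
elim: phi sigma => [|b p IH|x p IH|p IHp q IHq|p IHp q IHq|X p IH|X] sigma
    ok gs //=.
- exact: IH.
- exact: IH.
- by move=> /andP[/IHp-> // /IHq->].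
- by move=> /andP[/IHp-> // /IHq->].
- move=> /andP[nexp gp]; apply/andP; split; last first.
    apply: IH gp; first by apply: var_or_closed_upd => //; left.
    by move=> Y /=; case: eqP.
  apply/negP => /exposed_fsubst[Y expY] /=.
  case: eqP => [eqYX|neqYX]; first by rewrite -eqYX expY in nexp.
  case: (ok Y) => [->|cl]; first by move=> /= /eqP.
  by move=> /exposed_free; rewrite cl.
Qed.

Lemma closed_guarded_fsubst {sigma} phi : closing sigma -> guarded phi ->
  free_fvars (fsubst sigma phi) = fset0 /\ guarded (fsubst sigma phi).
Proof.
move=> cl gphi; split.
  apply/eqP/negPn/negP => /fset0Pn[Y /free_fvars_fsubst[X _]].
  by case: (cl X) => ->.
apply: guarded_fsubst => // [|X]; last by case: (cl X).
exact: closing_var_or_closed.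
Qed.

Lemma closing_const : closing (fun=> FTt).
Proof. by []. Qed.

Lemma closing_upd {sigma} X psi : closing sigma ->
    free_fvars psi = fset0 -> guarded psi ->
  closing [eta sigma with X |-> psi].
Proof. by move=> cl clpsi gpsi Y /=; case: eqP. Qed.

(** The unfolding substitution is the identity away from [X] and hence not closing, but [p] has no
    other free recursion variable, so it may be replaced by a closing one. *)
Lemma closed_guarded_unfold X p :
    free_fvars (FMin X p) = fset0 -> guarded (FMin X p) ->
  free_fvars (fsubst [eta FRec with X |-> FMin X p] p) = fset0 /\
  guarded (fsubst [eta FRec with X |-> FMin X p] p).
Proof.
move=> clX gX; case/andP: (gX) => _ gp.
have -> : fsubst [eta FRec with X |-> FMin X p] p =
          fsubst [eta (fun=> FTt) with X |-> FMin X p] p.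
  apply: fsubst_ext => Y Yin /=; case: eqP => // /eqP neqYX.
  by have := in_fset0 Y; rewrite -clX /= !inE neqYX Yin.
apply: closed_guarded_fsubst gp.
exact: closing_upd closing_const clX gX.
Qed.

(** For [FMin], the two operators agree at every [G], so their least fixed points do too. Capture of
    data variables by [FEx] is harmless, since both sides interpret [sigma X] in the current data
    environment. *)
Lemma sem_fsubst phi sigma rho : var_or_closed sigma ->
  sem (fsubst sigma phi) rho = sem phi (fun X => sem (sigma X) rho).
Proof.
elim: phi sigma rho => [|b p IH|x p IH|p IHp q IHq|p IHp q IHq|X p IH|X]
    sigma rho ok //=; rewrite ?IH ?IHp ?IHq //.
suff eqG G : sem (fsubst [eta sigma with X |-> FRec X] p) [eta rho with X |-> G] =
             sem p [eta (fun Y => sem (sigma Y) rho) with X |-> G].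
  apply/funext => delta.
  suff -> : (fun G => sem (fsubst [eta sigma with X |-> FRec X] p)
                          [eta rho with X |-> G]) =
            (fun G => sem p [eta (fun Y => sem (sigma Y) rho) with X |-> G]) by [].
  exact/funext.
rewrite IH; last by apply: var_or_closed_upd => //; left.
apply: eq_sem_free => Y _ /=; case: eqP => [_|/eqP neqYX] /=.
  by apply/funext => delta /=; rewrite eqxx.
case: (ok Y) => [->|cl]; last exact: sem_closed.
by apply/funext => delta /=; rewrite (negPf neqYX).
Qed.

Lemma sem_fsubst_min X p rho : free_fvars (FMin X p) = fset0 ->
  sem (fsubst [eta FRec with X |-> FMin X p] p) rho = sem (FMin X p) rho.
Proof.
move=> cl; rewrite sem_fsubst => [|Y /=]; last first.
  by case: eqP; [right | left].
rewrite -[RHS]sem_min_unfold; apply: eq_sem_free => Y _ /=.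
by case: eqP.
Qed.

(** Makes the silent unfolding of a [MRec] the synthesis of an unfolded formula, so that reachable
    monitors stay in the image of [syn]. *)
Lemma syn_fsubst X psi phi :
  syn (fsubst [eta FRec with X |-> psi] phi) = msubst X (syn psi) (syn phi).
Proof.
elim: phi => [|b p IH|x p IH|p IHp q IHq|p IHp q IHq|Y p IH|Y] //=;
  rewrite ?IH ?IHp ?IHq //; last by case: eqP.
case: eqP => [eqYX|neqYX].
  (* The binder shadows [X]: [msubst] stops here, while [fsubst] continues with what is now the
     identity substitution. *)
  congr MRec; rewrite -[in RHS](fsubst_id p); congr syn.
  apply: fsubst_ext => Z _ /=; case: eqP => [->//|]; rewrite eqYX.
  by case: eqP.
rewrite -IH; congr (MRec _ (syn _)).
apply: fsubst_ext => Z _ /=; case: eqP => [->|//].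
by case: eqP.
Qed.

End Logic.

(** * Composition of runs and runs of parallel configurations *)

Section Operational.
Context {D DVar FVar : countType}.
Implicit Types (c : config D DVar FVar) (phi p : formula DVar FVar) (w : seq D).
Implicit Types (delta : {fmap DVar -> D}) (t u : trace D).
Implicit Types (sigma : FVar -> formula DVar FVar).

Lemma wsteps_cat {c c' c'' w w'} :
  wsteps c w c' -> wsteps c' w' c'' -> wsteps c (w ++ w') c''.
Proof.
elim=> [//|c1 c2 c3 v st _ IH|c1 c2 c3 d v st _ IH] st'.
  exact: wsteps_tau st (IH st').
exact: wsteps_data st (IH st').
Qed.

Lemma wsteps_taur o {c1 c2 c2'} :
  wsteps c2 [::] c2' -> wsteps (CPar o c1 c2) [::] (CPar o c1 c2').
Proof.
move eqw: [::] => w steps.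
elim: steps eqw => [c|c c' c'' v st _ IH eqv|//]; first by constructor.
exact: wsteps_tau (step_taur o c1 st) (IH eqv).
Qed.

Lemma wsteps_consP {c d w c''} : wsteps c (d :: w) c'' ->
  exists c1 c2, [/\ wsteps c [::] c1, step c1 (Some d) c2 & wsteps c2 w c''].
Proof.
move eqv: (d :: w) => v steps.
elim: steps eqv => [//|c1 c2 c3 v1 st _ IH /IH|c1 c2 c3 d' v1 st steps _ [-> ->]].
  case=> [c4 [c5 [steps st' steps']]]; exists c4, c5; split=> //.
  exact: wsteps_tau st steps.
by exists c1, c2; split=> //; constructor.
Qed.

(** Silent moves interleave freely but data moves synchronise: before each datum read by the first
    run, the silent moves that the second run makes ahead of that datum are replayed. *)
Lemma wsteps_par o {c1 c1' c2 c2' w} : wsteps c1 w c1' -> wsteps c2 w c2' ->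
  wsteps (CPar o c1 c2) w (CPar o c1' c2').
Proof.
move=> steps1; elim: steps1 c2 => [c|c c' c'' v st _ IH|c c' c'' d v st _ IH] c2.
- exact: wsteps_taur.
- by move=> /IH; apply: wsteps_tau; apply: step_taul.
- case/wsteps_consP=> [c3 [c4 [taus st' steps]]].
  rewrite -[_ :: _]cat0s; apply: wsteps_cat (wsteps_taur o taus) _.
  exact: wsteps_data (step_sync o st st') (IH _ steps).
Qed.

Lemma wsteps_yes delta w :
  wsteps (CMon (@MYes DVar FVar) delta) w (CMon MYes delta).
Proof.
elim: w => [|d w IH]; first by constructor.
exact: wsteps_data (step_yes _ _ _) IH.
Qed.

(** * Denotations of configurations: soundness and progress *)

Local Notation sem0 phi :=
  (sem phi (fun (_ : FVar) (_ : {fmap DVar -> D}) => set0)).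

Definition par_set (o : par_op) : set (trace D) -> set (trace D) -> set (trace D) :=
  if o is Oplus then setU else setI.

(* [denotes c S]: [S] is the set of traces that [c] ought to accept. The rules
   cover exactly the configurations reached from synthesised monitors. *)
Inductive denotes : config D DVar FVar -> set (trace D) -> Prop :=
| denotes_end delta : denotes (CMon MEnd delta) set0
| denotes_syn phi delta : free_fvars phi = fset0 -> guarded phi ->
    denotes (CMon (syn phi) delta) (sem0 phi delta)
| denotes_par o c1 c2 S1 S2 : denotes c1 S1 -> denotes c2 S2 ->
    denotes (CPar o c1 c2) (par_set o S1 S2).

Lemma denotes_monE {m delta S} : denotes (CMon m delta) S ->
  (m = MEnd /\ S = set0) \/
  exists2 phi, m = syn phi &
    [/\ free_fvars phi = fset0, guarded phi & S = sem0 phi delta].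
Proof.
move eqc: (CMon m delta) => c den.
case: den eqc => [d0 [-> _]|phi d0 cl g [-> ->]|//]; first by left.
by right; exists phi.
Qed.

Lemma denotes_parE {o c1 c2 S} : denotes (CPar o c1 c2) S ->
  exists S1 S2, [/\ denotes c1 S1, denotes c2 S2 & S = par_set o S1 S2].
Proof.
move eqc: (CPar o c1 c2) => c den.
case: den eqc => [//|//|o' c1' c2' S1 S2 den1 den2 [-> -> ->]].
by exists S1, S2.
Qed.

Lemma denotes_yesE {delta S} : denotes (CMon MYes delta) S -> S = setT.
Proof. by move=> /denotes_monE[[]//|[[] // _ [_ _ ->]]]. Qed.

Lemma par_setS {o S1 S1' S2 S2'} {f : trace D -> trace D} :
    (forall u, S1' u -> S1 (f u)) -> (forall u, S2' u -> S2 (f u)) ->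
  forall u, par_set o S1' S2' u -> par_set o S1 S2 (f u).
Proof.
move=> sub1 sub2 u; case: o => /=.
  by case=> [/sub1|/sub2]; [left | right].
by case=> /sub1 ? /sub2.
Qed.

Definition label_cons (l : option D) u : trace D :=
  if l is Some d then tcons d u else u.

(** Only an inclusion can be expected, since a guess commits to one member of a union. Inverting
    [denotes] recovers the formula behind each monitor. *)
Lemma denotes_step {c l c' S} : step c l c' -> denotes c S ->
  exists2 S', denotes c' S' & forall u, S' u -> S (label_cons l u).
Proof.
move=> st; elim: st S => {c l c'}.
- by move=> delta d S den; rewrite (denotes_yesE den); exists S.
- move=> delta d S /denotes_monE[[_ ->]|[[]//]].
  by exists set0 => //; constructor.
- move=> b m delta d bd S /denotes_monE[[]//|[[] // b' p [eqb ->] [cl g ->]]].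
  exists (sem0 p delta); first exact: denotes_syn.
  by move=> u pu; exists d, u; rewrite -eqb.
- move=> b m delta d _ S _; exists set0 => //; constructor.
- move=> x m delta d S /denotes_monE[[]//|[[] // x' p [-> ->] [cl g ->]]].
  exists (sem0 p (delta.[x' <- d])%fmap); first exact: denotes_syn.
  by move=> u pu; exists d.
- move=> X m delta S /denotes_monE[[]//|[[] // Y p [-> ->] [cl g ->]]].
  (* The unfolded monitor is the synthesis of the unfolded formula, whose semantics is that of
     [FMin Y p]. *)
  rewrite -(sem_fsubst_min Y p) // -[MRec Y _]/(syn (FMin Y p)) -syn_fsubst.
  exists (sem0 (fsubst [eta FRec with Y |-> FMin Y p] p) delta) => //.
  by have [clp gp] := closed_guarded_unfold _ _ cl g; apply: denotes_syn.
- move=> o m n delta S /denotes_monE[[]//|[phi eqphi [cl g ->]]].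
  (* A parallel monitor is synthesised only from [FOr] or [FAnd]; [par_set] covers both at once. *)
  have {cl g} [p [q [-> -> -> [clp gp] [clq gq]]]] : exists p q,
      [/\ m = syn p, n = syn q,
         sem0 phi delta = par_set o (sem0 p delta) (sem0 q delta),
         free_fvars p = fset0 /\ guarded p & free_fvars q = fset0 /\ guarded q].
    case: phi eqphi cl g => //= p q [-> -> ->] /eqP;
      by rewrite fsetU_eq0 => /andP[/eqP clp /eqP clq] /andP[gp gq]; exists p, q.
  exists (par_set o (sem0 p delta) (sem0 q delta)) => //.
  by apply: denotes_par; apply: denotes_syn.
- move=> o c1 c1' c2 c2' d _ IH1 _ IH2 S.
  move=> /denotes_parE[S1 [S2 [/IH1[S1' den1 sub1] /IH2[S2' den2 sub2] ->]]].
  by exists (par_set o S1' S2'); [constructor | apply: par_setS].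
- move=> o c1 c1' c2 _ IH S /denotes_parE[S1 [S2 [/IH[S1' den1 sub1] den2 ->]]].
  by exists (par_set o S1' S2); [constructor | apply: (par_setS (f := id))].
- move=> o c1 c2 c2' _ IH S /denotes_parE[S1 [S2 [den1 /IH[S2' den2 sub2] ->]]].
  by exists (par_set o S1 S2'); [constructor | apply: (par_setS (f := id))].
- by move=> delta c S /denotes_parE[S1 [S2 [/denotes_yesE -> den2 ->]]]; exists S2.
- by move=> delta c S /denotes_parE[S1 [S2 [den1 /denotes_yesE -> ->]]]; exists S1.
- by move=> delta c S /denotes_parE[S1 [S2 [den1 _ ->]]]; exists S1 => // u; left.
- by move=> delta c S /denotes_parE[S1 [S2 [_ den2 ->]]]; exists S2 => // u; right.
Qed.

Definition trace_cat w u : trace D := foldr (@tcons D) u w.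

Lemma denotes_wsteps {c w c' S} : wsteps c w c' -> denotes c S ->
  exists2 S', denotes c' S' & forall u, S' u -> S (trace_cat w u).
Proof.
move=> steps; elim: steps S => [c1|c1 c2 c3 v st _ IH|c1 c2 c3 d v st _ IH] S den.
- by exists S.
- have [S2 /IH[S3 den3 sub32] sub21] := denotes_step st den.
  by exists S3 => // u /sub32/sub21.
- have [S2 /IH[S3 den3 sub32] sub21] := denotes_step st den.
  by exists S3 => // u /sub32/sub21.
Qed.

Lemma trace_cat_prefix t n :
  trace_cat (mkseq t n) (fun k => t (n + k)) = t.
Proof.
elim: n t => [|n IH] t; first by apply/funext => k; rewrite /trace_cat /= add0n.
have -> : mkseq t n.+1 = t 0 :: mkseq (fun k => t k.+1) n.
  by rewrite /mkseq /= -[1]/(1 + 0) iotaDl -map_comp.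
rewrite /=.
have -> : (fun k => t (n.+1 + k)) = (fun k => t (n + k).+1) by [].
by rewrite (IH (fun k => t k.+1)); apply/funext => -[|k].
Qed.

(** The induction is on an open formula with its closing substitution kept apart: unfolding a [FMin]
    then only updates [sigma], and the formula still decreases to the body. *)
Lemma progress {phi sigma} delta d : closing sigma -> guarded phi ->
    (forall X, ~~ exposed X phi) ->
  exists c, wsteps (CMon (syn (fsubst sigma phi)) delta) [:: d] c.
Proof.
elim: phi sigma delta => [|b p IH|x p IH|p IHp q IHq|p IHp q IHq|X p IH|X]
    sigma delta cl /=.
- by move=> _ _; eexists; apply: wsteps_data (step_yes _ _ _) _; constructor.
- move=> _ _; case: (boolP (holds delta d b)) => bd; eexists.
    by apply: wsteps_data (step_cond_true _ bd) _; constructor.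
  by apply: wsteps_data (step_cond_false _ bd) _; constructor.
(* Any datum would do for the guess; [d] is the one at hand. *)
- move=> gp nexp; have [c steps] := IH sigma (delta.[x <- d])%fmap cl gp nexp.
  by exists c; apply: wsteps_tau (step_guess _ _ _ _) steps.
- move=> /andP[gp gq] nexp.
  have [|c1 steps1] := IHp sigma delta cl gp.
    by move=> X; move: (nexp X); rewrite negb_or => /andP[].
  have [|c2 steps2] := IHq sigma delta cl gq.
    by move=> X; move: (nexp X); rewrite negb_or => /andP[].
  by eexists; apply: wsteps_tau (step_fork _ _ _ _) (wsteps_par _ steps1 steps2).
- move=> /andP[gp gq] nexp.
  have [|c1 steps1] := IHp sigma delta cl gp.
    by move=> X; move: (nexp X); rewrite negb_or => /andP[].
  have [|c2 steps2] := IHq sigma delta cl gq.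
    by move=> X; move: (nexp X); rewrite negb_or => /andP[].
  by eexists; apply: wsteps_tau (step_fork _ _ _ _) (wsteps_par _ steps1 steps2).
- move=> /andP[nexpX gp] nexp.
  have gX : guarded (FMin X p) by rewrite /= nexpX.
  have [clX gX'] := closed_guarded_fsubst (FMin X p) cl gX.
  have [|c] := IH _ delta (closing_upd X _ cl clX gX') gp.
    (* Only [X] itself could be exposed in [p] and not in [FMin X p]; guardedness rules it out. *)
    move=> Y; have := nexp Y; rewrite negb_and negbK.
    by case/orP => // /eqP <-.
  rewrite -(fsubst_unfold _ _ _ cl) syn_fsubst => steps.
  by exists c; apply: wsteps_tau (step_rec _ _ _) steps.
- by move=> _ /(_ X); rewrite eqxx.
Qed.

Lemma exposed_closed {phi} X : free_fvars phi = fset0 -> ~~ exposed X phi.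
Proof. by move=> cl; apply/negP => /exposed_free; rewrite cl. Qed.

Lemma denotes_progress {c S} d : denotes c S -> exists c', wsteps c [:: d] c'.
Proof.
elim=> [delta|phi delta cl gphi|o c1 c2 ? ? _ [c1' st1] _ [c2' st2]].
- by eexists; apply: wsteps_data (step_end _ _ _) _; constructor.
- rewrite -(fsubst_closed (fun _ => FTt) cl).
  exact: progress closing_const gphi (fun X => exposed_closed X cl).
- by eexists; apply: wsteps_par st1 st2.
Qed.

(** [denotes] is preserved along runs, so one-datum progress iterates. *)
Lemma denotes_run {c S} w : denotes c S -> exists c', wsteps c w c'.
Proof.
elim: w c S => [|d w IH] c S den; first by exists c; constructor.
have [c1 st] := denotes_progress d den.
have [S1 /IH[c2 steps] _] := denotes_wsteps st den.
by exists c2; apply: wsteps_cat st steps.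
Qed.

(** * Acceptance from an arbitrary data environment, and completeness *)

Definition accepts phi delta t : Prop := exists n delta',
  wsteps (CMon (syn phi) delta) (mkseq t n) (CMon MYes delta').

Lemma accepts_dia b p delta d u :
  holds delta d b -> accepts p delta u -> accepts (FDia b p) delta (tcons d u).
Proof.
move=> bd [n [delta' steps]]; exists n.+1, delta'.
have -> : mkseq (tcons d u) n.+1 = d :: mkseq u n.
  by rewrite /mkseq /= -[1]/(1 + 0) iotaDl -map_comp.
exact: wsteps_data (step_cond_true _ bd) steps.
Qed.

Lemma wsteps_tau_rcons {c w c' c''} :
  wsteps c w c' -> step c' None c'' -> wsteps c w c''.
Proof.
move=> steps st; rewrite -[w]cats0; apply: wsteps_cat steps _.
by apply: wsteps_tau st _; constructor.
Qed.

Lemma closed_run {phi} delta w : free_fvars phi = fset0 -> guarded phi ->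
  exists c, wsteps (CMon (syn phi) delta) w c.
Proof. by move=> cl gphi; exact: denotes_run w (denotes_syn _ delta cl gphi). Qed.

Lemma accepts_orl p q delta t : free_fvars q = fset0 -> guarded q ->
  accepts p delta t -> accepts (FOr p q) delta t.
Proof.
move=> cl gq [n [delta' steps]].
have [c steps'] := closed_run delta (mkseq t n) cl gq.
exists n, delta'; apply: wsteps_tau (step_fork _ _ _ _) _.
exact: wsteps_tau_rcons (wsteps_par _ steps steps') (step_orl _ _).
Qed.

Lemma accepts_orr p q delta t : free_fvars p = fset0 -> guarded p ->
  accepts q delta t -> accepts (FOr p q) delta t.
Proof.
move=> cl gq [n [delta' steps]].
have [c steps'] := closed_run delta (mkseq t n) cl gq.
exists n, delta'; apply: wsteps_tau (step_fork _ _ _ _) _.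
exact: wsteps_tau_rcons (wsteps_par _ steps' steps) (step_orr _ _).
Qed.

Lemma accepts_and p q delta t :
  accepts p delta t -> accepts q delta t -> accepts (FAnd p q) delta t.
Proof.
(* The two components may accept on different prefixes; as [yes] loops on every datum, both runs
   extend to the longer one. *)
have extend c n k delta' : n <= k -> wsteps c (mkseq t n) (CMon MYes delta') ->
    wsteps c (mkseq t k) (CMon MYes delta').
  move=> /subnKC <- steps; rewrite /mkseq iotaD map_cat.
  exact: wsteps_cat steps (wsteps_yes _ _).
move=> [n1 [delta1 /(extend _ _ _ _ (leq_maxl n1 _)) steps1]].
move=> [n2 [delta2 /(extend _ _ _ _ (leq_maxr _ n2)) steps2]].
exists (maxn n1 n2), delta2; apply: wsteps_tau (step_fork _ _ _ _) _.
exact: wsteps_tau_rcons (wsteps_par _ (steps1 n2) (steps2 n1)) (step_andl _ _).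
Qed.

Lemma accepts_complete {phi sigma} {rho : FVar -> dinterp D DVar} :
    closing sigma -> guarded phi ->
    (forall X delta t, rho X delta t -> accepts (sigma X) delta t) ->
  forall delta t, sem phi rho delta t -> accepts (fsubst sigma phi) delta t.
Proof.
elim: phi sigma rho => [|b p IH|x p IH|p IHp q IHq|p IHp q IHq|X p IH|X]
    sigma rho cl /= gphi sub delta t.
- by move=> _; exists 0, delta; constructor.
- by case=> d [u [-> bd /(IH _ _ cl gphi sub)]]; apply: accepts_dia.
- case=> d _ /(IH _ _ cl gphi sub)[n [delta' steps]].
  exists n, delta'; exact: wsteps_tau (step_guess _ _ _ _) steps.
- case/andP: gphi => gp gq.
  have [clp gp'] := closed_guarded_fsubst p cl gp.
  have [clq gq'] := closed_guarded_fsubst q cl gq.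
  case=> [/(IHp _ _ cl gp sub)|/(IHq _ _ cl gq sub)].
    exact: accepts_orl.
  exact: accepts_orr.
- case/andP: gphi => gp gq.
  by case=> /(IHp _ _ cl gp sub) accp /(IHq _ _ cl gq sub); apply: accepts_and.
- have [clX gX'] := closed_guarded_fsubst (FMin X p) cl gphi.
  case/andP: (gphi) => _ gp.
  (* Acceptance is itself a data interpretation, because [accepts] ranges over all data
     environments; it serves as the pre-fixed point. *)
  apply: (sem_min_ind (accepts (fsubst sigma (FMin X p)))) => {}delta {}t.
  move=> /(IH _ _ (closing_upd X _ cl clX gX') gp) acc_unfold.
  have [Y delta1 t1 /=|n [delta' steps]] := acc_unfold.
    by case: eqP => // _; apply: sub.
  (* The accepting run starts from the unfolded monitor, one silent step after the [MRec]. *)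
  move: steps; rewrite -(fsubst_unfold _ _ _ cl) syn_fsubst => steps.
  exists n, delta'; exact: wsteps_tau (step_rec _ _ _) steps.
- exact: sub.
Qed.

End Operational.

Theorem proposition52 (D DVar FVar : countType)
    (infinite_D : infinite_set [set: D])
    (infinite_DVar : infinite_set [set: DVar])
    (infinite_FVar : infinite_set [set: FVar])
    (phi : formula DVar FVar)
    (closed_phi : closed_formula phi) (guarded_phi : guarded phi) :
  sound D (syn phi) phi /\ satisfaction_complete D (syn phi) phi.
Proof.
case: closed_phi => _ cl; split=> t.
  case=> n [delta' steps].
  have [S' /denotes_yesE -> sub] :=
    denotes_wsteps steps (denotes_syn _ _ cl guarded_phi).
  (* The final [yes] denotes every trace, in particular what remains of [t] after the prefix
     read. *)
  by rewrite -(trace_cat_prefix t n); apply: sub.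
(* Any closing substitution fixes the closed [phi]; the trace environment of [csem] is empty
   everywhere, so the condition relating it to acceptance is vacuous. *)
move=> satt; rewrite /acc -[phi](fsubst_closed (fun _ => FTt) cl).
exact: (accepts_complete closing_const guarded_phi _ _ _ satt).
Qed.
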